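(* If a signed bipartite graph $G$ contains an alternating cycle of positive and negative edges, then $I^+_G(x)=0$.
   Context: Graphs are finite; parallel edges are allowed; graphs need not be planar or connected. A bipartite graph $G=(V,E,\mathcal{E})$ has color classes $V$ and $E$ (both consisting of vertices) and edge set $\mathcal{E}$. An alternating cycle is a cycle of $G$ whose edges are alternately positive and negative (a cycle of length $2$ formed by two parallel edges of opposite sign is included). **Interior polynomial.** If $G$ is connected, a hypertree is a function $f:E\to\mathbb{Z}_{\ge 0}$ such that $G$ has a spanning tree with degree $f(e)+1$ at every $e\in E$. Fix a total order on $E$. Given a hypertree $f$, an element $e\in E$ is internally inactive if there is some $e'<e$ such that decreasing $f(e)$ by $1$ and increasing $f(e')$ by $1$ yields a hypertree. The interior polynomial is $I_G(x)=\sum_f x^{\bar\iota(f)}$, where $f$ runs over all hypertrees and $\bar\iota(f)$ is the number of internally inactive elements of $E$; for a single-vertex graph $I_G(x)=1$. (It is known that $I_G$ does not depend on the order and is unchanged when the roles of $V$ and $E$ are exchanged.) For a possibly disconnected $G$ with connected components $G_1,\dots,G_{k}$, $k=k(G)$, set $I'_G(x)=(1-x)^{k-1}\prod_{i=1}^{k}I_{G_i}(x)$. **Signed interior polynomial.** A signed bipartite graph has a sign $\mathcal{E}\to\{+1,-1\}$; $\mathcal{E}_-(G)$ denotes its set of negative edges. For $\mathcal{S}\subseteq\mathcal{E}_-(G)$, $G\setminus\mathcal{S}$ is the unsigned bipartite graph obtained by deleting the edges in $\mathcal{S}$ (keeping all vertices) and forgetting signs. Then $I^+_G(x)=\sum_{\mathcal{S}\subseteq\mathcal{E}_-(G)}(-1)^{|\mathcal{S}|}I'_{G\setminus\mathcal{S}}(x)$.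 *)

(* Defs.v *)
From HB Require Import structures.
From mathcomp Require Import all_boot all_order all_algebra.

Set Implicit Arguments.
Unset Strict Implicit.
Unset Printing Implicit Defensive.

Import GRing.Theory.
Local Open Scope ring_scope.

(* Parallel edges are allowed because edges form a type of their own. *)
Record bigraph := BiGraph {
  Vclass : finType;
  Eclass : finType;
  edge : finType;
  Vend : edge -> Vclass;
  Eend : edge -> Eclass }.

Definition vertex (G : bigraph) : finType := (Vclass G + Eclass G)%type.

Definition joins (G : bigraph) (a : edge G) (x y : vertex G) : bool :=
  (x == inl (Vend a)) && (y == inr (Eend a))
  || (x == inr (Eend a)) && (y == inl (Vend a)).

Definition adj (G : bigraph) (T : {set edge G}) : rel (vertex G) :=
  [rel x y | [exists a in T, joins a x y]].

(* [:: (x_0, a_0); ...; (x_n, a_n)] stands for the closed walk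
   x_0 a_0 x_1 a_1 ... x_n a_n x_0.  Requiring the edges to be distinct matters
   only for length 2, where it forces the two edges to be parallel. *)
Definition is_cycle (G : bigraph) (c : seq (vertex G * edge G)) : bool :=
  [&& c != [::],
      cycle (fun p q => joins p.2 p.1 q.1) c,
      uniq [seq p.1 | p <- c]
    & uniq [seq p.2 | p <- c]].

(* The bound on the length of c is harmless: see acyclicP. *)
Definition acyclic (G : bigraph) (T : {set edge G}) : bool :=
  [forall c : #|edge G|.-bseq (vertex G * edge G),
     ~~ (is_cycle c && all (fun p => p.2 \in T) c)].

Lemma acyclicP (G : bigraph) (T : {set edge G}) :
  reflect (forall c, is_cycle c -> ~~ all (fun p => p.2 \in T) c)
          (acyclic T).
Proof.
apply: (iffP forallP) => [noc c cyc_c | noc c]; last first.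
  by apply/negP => /andP[/noc/negP].
have sz_c : (size c <= #|edge G|)%N.
  case/and4P: cyc_c => _ _ _ /card_uniqP; rewrite size_map => <-.
  exact: max_card.
by have := noc (Bseq sz_c); rewrite /= cyc_c.
Qed.

Definition spanning_tree (G : bigraph) (T : {set edge G}) : bool :=
  [forall x, forall y, connect (adj T) x y] && acyclic T.

Definition degE (G : bigraph) (T : {set edge G}) (e : Eclass G) : nat :=
  #|[set a in T | Eend a == e]|.

Definition hypertree (G : bigraph) (f : Eclass G -> nat) : bool :=
  [exists T : {set edge G},
     spanning_tree T && [forall e, degE T e == (f e).+1]].

Lemma hypertree_lt (G : bigraph) (f : Eclass G -> nat) (e : Eclass G) :
  hypertree f -> (f e < #|edge G|)%N.
Proof.
by case/existsP=> T /andP[_ /forallP/(_ e)/eqP<-]; apply: max_card.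
Qed.

Definition transfer (T : eqType) (f : T -> nat) (e e' : T) : T -> nat :=
  fun u => (f u - (u == e) + (u == e'))%N.

(* Truncated subtraction forces the explicit condition 0 < f e. *)
Definition inactive (G : bigraph) (le : rel (Eclass G)) (f : Eclass G -> nat)
    (e : Eclass G) : bool :=
  [exists e', [&& le e' e, e' != e, (0 < f e)%N & hypertree (transfer f e e')]].

(* Meant for connected G.  By hypertree_lt, f ranges over all hypertrees.
   The convention for a single vertex is needed when that vertex lies in
   Eclass G, since it then has degree 0 and there is no hypertree. *)
Definition interior_poly (G : bigraph) (le : rel (Eclass G)) : {poly int} :=
  if #|vertex G| == 1%N then 1
  else \sum_(f : {ffun Eclass G -> 'I_#|edge G|}
              | hypertree (fun e : Eclass G => f e : nat))
         'X^#|[set e | inactive le (fun e' => f e' : nat) e]|.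

Definition components (G : bigraph) : {set {set vertex G}} :=
  equivalence_partition (connect (adj [set: edge G])) [set: vertex G].

Definition inside (G : bigraph) (C : {set vertex G}) (a : edge G) : bool :=
  (inl (Vend a) \in C) && (inr (Eend a) \in C).

Definition induced (G : bigraph) (C : {set vertex G}) : bigraph :=
  @BiGraph {v : Vclass G | inl v \in C} {e : Eclass G | inr e \in C}
    {a : edge G | inside C a}
    (fun a => exist (fun v => inl v \in C) (Vend (val a)) (andP (valP a)).1)
    (fun a => exist (fun e => inr e \in C) (Eend (val a)) (andP (valP a)).2).

Definition induced_rel (G : bigraph) (C : {set vertex G})
    (le : rel (Eclass G)) : rel (Eclass (induced C)) :=
  fun e e' => le (val e) (val e').

(* The exponent is truncated only for the graph without vertices. *)
Definition interior_poly' (G : bigraph) (le : rel (Eclass G)) : {poly int} :=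
  (1 - 'X) ^+ #|components G|.-1
  * \prod_(C in components G) interior_poly (@induced_rel G C le).

Definition delete_edges (G : bigraph) (S : {set edge G}) : bigraph :=
  @BiGraph (Vclass G) (Eclass G) {a : edge G | a \notin S}
    (fun a => Vend (val a)) (fun a => Eend (val a)).

Record signed_bigraph := SignedBiGraph {
  unsigned :> bigraph;
  neg_edges : {set edge unsigned} }.

Definition alternating_cycle (G : signed_bigraph)
    (c : seq (vertex G * edge G)) : bool :=
  is_cycle c
  && cycle (fun p q => (p.2 \in neg_edges G) != (q.2 \in neg_edges G)) c.

Definition signed_interior_poly (G : signed_bigraph) (le : rel (Eclass G)) :
    {poly int} :=
  \sum_(S : {set edge G} | S \subset neg_edges G)
     (-1) ^+ #|S| * @interior_poly' (delete_edges S) le.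

(* Main.v *)
Require Import Defs.
From HB Require Import structures.
From mathcomp Require Import all_boot all_order all_algebra.
From mathcomp Require Import zify.

Set Implicit Arguments.
Unset Strict Implicit.
Unset Printing Implicit Defensive.

Import GRing.Theory.

(** Write n for the number of vertices.  A set U of vertices is closed if it
contains the neighbours of its elements of E, and a vector z on E with values
in nat is sparse if z(U) < #|U| for every nonempty closed U, where z(U) sums z
over the elements of E in U.  When G is connected and has more than one vertex,
the maximal sparse vectors are the degree vectors f + 1 of spanning trees, for
f a hypertree ([hypertree_base]), and the sparse vectors are the natural vectors
below them.

The first half of the proof is the identity ([interior_poly'_sparse])
<<
  I'_G(1 - x) = sum over sparse z of x^(n - 1 - |z|) (1 - x)^(#|supp z|).
>>
For connected G, every sparse z lies below exactly one vector f + 1 that it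
meets in all internally inactive elements of f: the lexicographically largest
hypertree above z, where elements that come early in the order weigh most.  The
vectors z attached to a given f form a box, over which the right hand side sums
to (1 - x) to the number of inactive elements.  For general G both sides are
products over the connected components; the factor (1 - x)^(k-1) of I' becomes
x^(k-1), which is what is missing when the exponents n_i - 1 of the components
are added up to n - 1.

In this identity only the range of z depends on the edges, so it remains to
prove, for each fixed z ([alternating_sparse_sum0]),
<<
  sum over S of (-1)^|S| [z is sparse for G \ S] = 0.
>>
The closed sets that violate sparseness, when there are any, form a poset with
contractible order complex, so [z is sparse for G \ S] is the sum of (-1)^|W|
over all chains W of violating sets that are closed in G \ S
([sparse_chains]).  The members of W are closed in G \ S exactly when S contains every
edge ve such that some member of W contains e but not v.  Summing over S first,
W contributes only if these edges are exactly the negative ones.  But then the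
number p(x) of members of W that contain the vertex x satisfies p(v) >= p(e)
along positive edges ve and p(v) < p(e) along negative ones.  Around an
alternating cycle, where signs and sides alternate together, p is monotone, hence
constant, which contradicts the strict inequality at a negative edge. *)

(** * Sparse vectors *)

Lemma transferE (T : eqType) (f : T -> nat) (e e' u : T) : 0 < f e -> e != e' ->
  transfer f e e' u + (u == e) = f u + (u == e').
Proof.
rewrite /transfer; case: (u =P e) => [->|_] fe ee'; last by rewrite subn0 addn0.
by rewrite (negbTE ee') !addn0 subnK.
Qed.

Section Sparse.
Variable G : bigraph.
Implicit Types (T S : {set edge G}) (U W : {set vertex G}) (z : Eclass G -> nat).

(** A closed set plays the role of a set X of E-vertices together with its
neighbourhood N(X); extra V-vertices only weaken the condition in [sparse]. *)
Definition eclosed T U :=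
  [forall a in T, (inr (Eend a) \in U) ==> (inl (Vend a) \in U)].

Definition esum z U := \sum_(e | inr e \in U) z e.

Definition sparse T z :=
  [forall U, (U != set0) && eclosed T U ==> (esum z U < #|U|)].

Definition tight T z U := [&& U != set0, eclosed T U & (esum z U).+1 == #|U|].

(** For connected graphs these turn out to be the degree vectors of spanning
trees, see [hypertree_base]; the value of the sum is the largest one that
sparseness of [setT] allows. *)
Definition base z := sparse setT z && ((\sum_e z e).+1 == #|vertex G|).

Lemma eclosedP T U :
  reflect (forall a, a \in T -> inr (Eend a) \in U -> inl (Vend a) \in U)
          (eclosed T U).
Proof.
by apply: (iffP forall_inP) => h a aT; move: (h a aT) => /implyP.
Qed.

Lemma sparseP T z :
  reflect (forall U, U != set0 -> eclosed T U -> esum z U < #|U|) (sparse T z).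
Proof.
apply: (iffP forallP) => h U; last by apply/implyP => /andP[]; apply: h.
by move=> U0 clU; have := h U; rewrite U0 clU.
Qed.

Lemma eclosedS T S U : T \subset S -> eclosed S U -> eclosed T U.
Proof. by move=> /subsetP sub /eclosedP h; apply/eclosedP => a /sub/h. Qed.

Lemma eclosedU T U W : eclosed T U -> eclosed T W -> eclosed T (U :|: W).
Proof.
move=> /eclosedP hU /eclosedP hW; apply/eclosedP => a aT; rewrite !inE.
by case/orP=> [/(hU a aT)|/(hW a aT)] ->; rewrite ?orbT.
Qed.

Lemma eclosedI T U W : eclosed T U -> eclosed T W -> eclosed T (U :&: W).
Proof.
move=> /eclosedP hU /eclosedP hW; apply/eclosedP => a aT; rewrite !inE.
by case/andP=> /(hU a aT)-> /(hW a aT)->.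
Qed.

Lemma eclosedT T : eclosed T setT.
Proof. by apply/eclosedP => a _ _; rewrite inE. Qed.

Lemma sparseS T S z : T \subset S -> sparse T z -> sparse S z.
Proof.
by move=> TS /sparseP sp; apply/sparseP => U U0 /(eclosedS TS); apply: sp.
Qed.

(** Both sides of the inequality defining [sparse] are modular, so equality
passes to unions and intersections; this drives all exchange arguments. *)
Lemma esumUI z U W : esum z (U :|: W) + esum z (U :&: W) = esum z U + esum z W.
Proof.
rewrite /esum !(big_mkcond (fun e => inr e \in _)) -!big_split /=.
apply: eq_bigr => e _; rewrite !inE.
by case: (inr e \in U); case: (inr e \in W); rewrite ?addn0.
Qed.

Lemma esum_setT z : esum z setT = \sum_e z e.
Proof. by apply: eq_bigl => e; rewrite inE. Qed.

Lemma esumD1 z U e : inr e \in U -> esum z U = z e + esum z (U :\ inr e).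
Proof.
move=> eU; rewrite /esum (bigD1 e) //=; congr (_ + _).
by apply: eq_bigl => e'; rewrite !inE andbC.
Qed.

Lemma esum_out z (v : Vclass G) U : esum z (inl v |: U) = esum z U.
Proof. by apply: eq_bigl => e; rewrite !inE. Qed.

Lemma leq_esum z (z' : Eclass G -> nat) U :
  (forall e, z e <= z' e) -> esum z U <= esum z' U.
Proof. by move=> le; apply: leq_sum. Qed.

Lemma sparse_le T z (z' : Eclass G -> nat) :
  (forall e, z e <= z' e) -> sparse T z' -> sparse T z.
Proof.
move=> le /sparseP sp; apply/sparseP => U U0 clU.
exact: leq_ltn_trans (leq_esum _ le) (sp U U0 clU).
Qed.

Lemma eq_sparse T z (z' : Eclass G -> nat) : z =1 z' -> sparse T z = sparse T z'.
Proof.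
by move=> eqz; apply: eq_forallb => U; rewrite /esum (eq_bigr z').
Qed.

Lemma tightUI T z U W :
    sparse T z -> tight T z U -> tight T z W -> U :&: W != set0 ->
  tight T z (U :|: W) /\ tight T z (U :&: W).
Proof.
move=> /sparseP sp /and3P[U0 clU /eqP eU] /and3P[W0 clW /eqP eW] UW0.
have clI := eclosedI clU clW; have clX := eclosedU clU clW.
have X0: U :|: W != set0.
  by apply: contraNneq U0 => X0; rewrite -subset0 -X0 subsetUl.
have := sp _ UW0 clI; have := sp _ X0 clX.
have := esumUI z U W; have := cardsUI U W => cUI eUI lX lI.
by split; rewrite /tight ?UW0 ?X0 ?clI ?clX; apply/eqP; lia.
Qed.

(** The tight sets through a vertex are stable under intersection. *)
Lemma tight_least T z U x :
    sparse T z -> tight T z U -> x \in U ->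
  exists M, [/\ tight T z M, x \in M &
               forall W, tight T z W -> x \in W -> M \subset W].
Proof.
move=> sp tU xU; have PU : tight T z U && (x \in U) by rewrite tU.
case: (@arg_minnP _ U (fun W => tight T z W && (x \in W)) (fun W => #|W|) PU) => M /andP[tM xM] minM.
exists M; split=> // W tW xW.
have MW0 : M :&: W != set0 by apply/set0Pn; exists x; rewrite inE xM.
have [_ tI] := tightUI sp tM tW MW0.
have := minM (M :&: W); rewrite tI inE xM xW => /(_ isT) cI.
by apply/setIidPl/eqP; rewrite eqEcard subsetIl.
Qed.

Definition incr z e : Eclass G -> nat := fun u => z u + (u == e).

Lemma esum_incr z e U : esum (incr z e) U = esum z U + (inr e \in U).
Proof.
rewrite /esum /incr big_split /=; congr (_ + _).
have [eU|eU] := boolP (inr e \in U).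
  rewrite (bigD1 e) //= eqxx big1 // => i /andP[_ /negbTE->] //.
by rewrite big1 // => i iU; case: eqP iU eU => // -> ->.
Qed.

(** Only a tight set can obstruct an increment. *)
Lemma incr_sparseN z e T :
  sparse T z -> ~~ sparse T (incr z e) -> exists2 U, tight T z U & inr e \in U.
Proof.
move=> /sparseP sp /forallPn[U]; rewrite negb_imply esum_incr -leqNgt.
case/andP=> /andP[U0 clU] h; have := sp U U0 clU => lU.
have eU : inr e \in U by apply: contraLR h => /negbTE->; rewrite addn0 -ltnNge.
exists U => //; rewrite /tight U0 clU; move: h; rewrite eU; lia.
Qed.

(** Connectedness, phrased without paths: this form is directly what the
arguments on closed sets use and what induced subgraphs inherit. *)
Definition indecomposable T := forall U, U != set0 ->
  (forall a, a \in T -> (inl (Vend a) \in U) = (inr (Eend a) \in U)) -> U = setT.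

Lemma sum_base z : sparse setT z -> 0 < #|vertex G| -> \sum_e z e < #|vertex G|.
Proof.
move=> /sparseP sp n0; rewrite -esum_setT -cardsT; apply: sp; last exact: eclosedT.
by rewrite -card_gt0 cardsT.
Qed.

(** Every E-vertex lies in a tight set.  If a largest tight set M were not
everything, an edge would join some V-vertex v of M to an E-vertex e outside;
a tight set through e contains v, so its union with M is tight and larger. *)
Lemma maximal_sparse_base (e0 : Eclass G) z : indecomposable setT -> sparse setT z ->
  (forall e, ~~ sparse setT (incr z e)) -> base z.
Proof.
move=> conn sp maxz; rewrite /base sp /=.
have [U0 tU0 _] := incr_sparseN sp (maxz e0).
case: (@arg_maxnP _ U0 (tight setT z) (fun W => #|W|) tU0) => M tM maxM.
suff MT : M = setT.
  by case/and3P: tM => _ _; rewrite MT esum_setT cardsT.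
case/and3P: (tM) => M0 /eclosedP clM _.
apply: conn M0 _ => a _; apply/idP/idP; last by apply: clM; rewrite inE.
move=> vM; apply: contraT => eM.
have [W tW eW] := incr_sparseN sp (maxz (Eend a)).
have vW : inl (Vend a) \in W.
  by case/and3P: tW => _ /eclosedP clW _; apply: clW; rewrite ?inE.
have MW0 : M :&: W != set0 by apply/set0Pn; exists (inl (Vend a)); rewrite inE vM.
have [tX _] := tightUI sp tM tW MW0.
have : #|M :|: W| <= #|M| := maxM _ tX.
rewrite leqNgt proper_card //.
apply/properP; split; first exact: subsetUl.
by exists (inr (Eend a)); rewrite ?inE ?eW ?orbT.
Qed.

(** Apply sparseness to the closed set consisting of e and its neighbours. *)
Lemma sparse_le_degE z T e : sparse T z -> z e <= degE T e.
Proof.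
move=> /sparseP sp.
pose A := [set a in T | Eend a == e].
pose U : {set vertex G} := inr e |: [set inl (Vend a) | a in A].
have U0 : U != set0 by apply/set0Pn; exists (inr e); rewrite setU11.
have clU : eclosed T U.
  apply/eclosedP => a aT; rewrite !inE => /orP[/eqP[Ea]|/imsetP[] //].
  by apply/orP; right; apply/imsetP; exists a; rewrite // !inE aT Ea /=.
have eU : inr e \in U by rewrite setU11.
have := sp U U0 clU; rewrite (esumD1 _ eU) => h.
rewrite -ltnS; apply: leq_trans (leq_ltn_trans (leq_addr _ _) h) _.
rewrite cardsU1; case: (_ \notin _) => /=; rewrite ?add0n ?add1n ?ltnS //.
  exact: leq_imset_card.
by apply: leqW; exact: leq_imset_card.
Qed.

(** The basis exchange property.  Lowering e and raising e' is harmless as soon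
as e lies in the least z-tight set M through e'; and since M is tight for z,
the vectors z and z' cannot satisfy z <= z' on M with z e' < z' e'. *)
Lemma base_exchange z (z' : Eclass G -> nat) e' : base z -> base z' -> z e' < z' e' ->
  exists2 e, z' e < z e & base (transfer z e e').
Proof.
move=> /andP[sp bz] /andP[/sparseP sp' _] lt.
have tT : tight setT z setT.
  rewrite /tight eclosedT esum_setT cardsT bz /= andbT.
  by apply/set0Pn; exists (inr e'); rewrite inE.
have [M [tM eM minM]] := tight_least sp tT (in_setT (inr e')).
case/and3P: (tM) => M0 clM /eqP zM.
have [/existsP[e /andP[eMM ze]]|/existsPn noe] :=
  boolP [exists e, (inr e \in M) && (z' e < z e)].
  have ee' : e != e' by apply: contraTneq ze => ->; rewrite -leqNgt ltnW.
  have eqd U : esum (transfer z e e') U + (inr e \in U) = esum z U + (inr e' \in U).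
    rewrite -!esum_incr; apply: eq_bigr => u _; rewrite /transfer /incr.
    by case: (u =P e) => [->|_]; rewrite ?(negbTE ee') /= ?subn0 ?addn0 //; lia.
  exists e => //; rewrite /base; apply/andP; split; last first.
    by have := eqd setT; rewrite !esum_setT !inE => /addIn->.
  apply/sparseP => U U0 clU; have := eqd U.
  have := sparseP _ _ sp U U0 clU => ltU.
  case: (boolP (inr e' \in U)) => [e'U|_]; last lia.
  case: (boolP (inr e \in U)) => [|eU]; first lia.
  case: (eqVneq (esum z U).+1 #|U|) => [eqU|]; last lia.
  have : M \subset U by apply: minM e'U; rewrite /tight U0 clU eqU eqxx.
  by move=> /subsetP/(_ _ eMM); rewrite (negbTE eU).
have := sp' M M0 clM; rewrite -zM ltnS leqNgt.
rewrite (esumD1 z eM) (esumD1 z' eM) -addSn leq_add //.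
apply: leq_sum => e; rewrite inE => /andP[_ eMM].
by have := noe e; rewrite eMM /= -leqNgt.
Qed.

Lemma base_gt0 z e : 1 < #|vertex G| -> base z -> 0 < z e.
Proof.
move=> n1 /andP[/sparseP sp /eqP bz]; have := sp [set~ inr e].
have -> : eclosed setT [set~ inr e] by apply/eclosedP => a; rewrite !inE.
have -> : [set~ inr e] != set0 :> {set vertex G}.
  by rewrite -card_gt0 cardsC1; move: n1; case: #|_| => [|[]].
move=> /(_ isT isT); rewrite cardsC1.
rewrite -bz -esum_setT (esumD1 z (in_setT (inr e))) /= setTD.
by rewrite -{1}[esum _ _]add0n ltn_add2r.
Qed.

Lemma eq_base z (z' : Eclass G -> nat) : z =1 z' -> base z = base z'.
Proof. by move=> eqz; rewrite /base (eq_sparse _ eqz) (eq_bigr z'). Qed.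
End Sparse.

(** * Spanning trees and maximal sparse vectors *)

Section Trees.
Variable G : bigraph.
Implicit Types (T S : {set edge G}) (U W : {set vertex G}) (z : Eclass G -> nat).

Lemma joinsC (a : edge G) x y : joins a x y = joins a y x.
Proof. by rewrite /joins orbC andbC [in X in _ || X]andbC. Qed.

Lemma joinsP (a : edge G) x y : joins a x y ->
  (x = inl (Vend a) /\ y = inr (Eend a)) \/ (x = inr (Eend a) /\ y = inl (Vend a)).
Proof. by case/orP=> /andP[/eqP-> /eqP->]; [left | right]. Qed.

Definition component T x : {set vertex G} := [set y | connect (adj T) x y].

Lemma adj_joins T a : a \in T -> adj T (inl (Vend a)) (inr (Eend a)).
Proof. by move=> aT; apply/exists_inP; exists a; rewrite // /joins !eqxx. Qed.

Lemma adj_sym T : connect_sym (adj T).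
Proof.
by apply: sym_connect_sym => x y; apply: eq_existsb => a; rewrite joinsC.
Qed.

Lemma component_refl T x : x \in component T x.
Proof. by rewrite inE connect0. Qed.

Lemma component_edge T x a : a \in T ->
  (inl (Vend a) \in component T x) = (inr (Eend a) \in component T x).
Proof.
move=> aT; rewrite !inE; apply: (same_connect_r (adj_sym T)).
exact: connect1 (adj_joins aT).
Qed.

(** Edges of [T] do not leave [U], so paths do not either. *)
Lemma component_min T x U : x \in U ->
  (forall a, a \in T -> (inl (Vend a) \in U) = (inr (Eend a) \in U)) ->
  component T x \subset U.
Proof.
move=> xU clU; apply/subsetP => y; rewrite inE => xy.
rewrite -(@closed_connect _ (adj T) (mem U) _ _ _ xy) // => u v.
case/exists_inP=> a aT /joinsP[[-> ->]|[-> ->]]; first exact: clU.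
by rewrite clU.
Qed.

Lemma componentS T S x : T \subset S -> component T x \subset component S x.
Proof.
move=> /subsetP TS; apply: component_min (component_refl S x) _ => a /TS aS.
exact: component_edge.
Qed.

Lemma connected_indecomposable T :
  (forall x y, connect (adj T) x y) <-> indecomposable T.
Proof.
split=> [conn U /set0Pn[x xU] clU | ind x y].
  apply/setP => y; rewrite [RHS]inE.
  by apply: (subsetP (component_min xU clU)); rewrite inE.
suff : y \in component T x by rewrite inE.
rewrite (ind (component T x)) ?inE // => [|a aT]; last exact: component_edge.
by apply/set0Pn; exists x; apply: component_refl.
Qed.

(** If both U and its complement were unions of components, sparseness of the
two would add up to a sum of z that is too small by one. *)
Lemma sparse_indecomposable T z :
  sparse T z -> (\sum_e z e).+1 = #|vertex G| -> indecomposable T.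
Proof.
move=> /sparseP sp sumz U U0 clU; apply: contraTeq isT => UT.
have CU0 : ~: U != set0 by apply: contraNneq UT => C0; rewrite -[U]setCK C0 setC0.
have clC : eclosed T (~: U).
  by apply/eclosedP => a aT; rewrite !inE clU.
have clU' : eclosed T U by apply/eclosedP => a aT; rewrite clU.
have := sp _ U0 clU'; have := sp _ CU0 clC; have := esumUI z U (~: U).
rewrite setUCr esum_setT setICr.
have -> : esum z set0 = 0 by apply: big1 => e; rewrite inE.
have := cardsC U; rewrite -sumz; lia.
Qed.

Lemma esum_degE T U : esum (degE T) U = #|[set a in T | inr (Eend a) \in U]|.
Proof.
rewrite -sum1_card (partition_big (@Eend G) (fun e => inr e \in U)) /=.
  by apply: eq_bigr => e eU; rewrite /degE -sum1_card; apply: eq_bigl => a;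
     rewrite !inE; case: eqP => [->|]; rewrite ?eU ?andbF ?andbT.
by move=> a; rewrite inE => /andP[].
Qed.

Lemma uniq_map_inj (A B : eqType) (f : A -> B) (s : seq A) :
  uniq (map f s) -> {in s &, injective f}.
Proof.
elim: s => //= x s IH /andP[xs us] u v; rewrite !inE.
case/predU1P=> [->|us']; case/predU1P=> [->|vs'] // euv.
- by case/negP: xs; rewrite euv map_f.
- by case/negP: xs; rewrite -euv map_f.
- exact: IH.
Qed.

(** On a cycle of T there are as many V-vertices as E-vertices, and each of the
former ends two edges.  So the E-vertices of the cycle together with their
neighbours form a closed set no larger than the sum of the degrees in it. *)
Lemma sparse_acyclic T : sparse T (degE T) -> acyclic T.
Proof.
move=> /sparseP sp; apply/acyclicP => c /and4P[c0 cyc_c u1 u2]; apply/negP => /allP cT.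
have uc := map_uniq u1.
(* A: the edges of T at the E-vertices of the cycle.  M: the edges of the
   cycle traversed from V to E, one for each V-vertex and each E-vertex. *)
pose A := [set a in T | inr (Eend a) \in [seq p.1 | p <- c]].
pose M := [set a | has (fun p => (p.2 == a) && (if p.1 is inl _ then true else false)) c].
pose U : {set vertex G} :=
  [set x | if x is inr e then x \in [seq p.1 | p <- c] else false]
  :|: [set inl (Vend a) | a in A].
have inM p (v : Vclass G) : p \in c -> p.1 = inl v -> p.2 \in M.
  by move=> pc pv; rewrite inE; apply/hasP; exists p; rewrite // pv eqxx.
have MP a : a \in M -> exists2 p, p \in c & p = (inl (Vend a), a).
  rewrite inE => /hasP[[x b] pc] /= /andP[/eqP eba] xl; exists (x, b) => //.
  have := next_cycle cyc_c pc; rewrite eba /= => /joinsP[[-> //]|[ex _]].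
  by rewrite ex in xl.
have MA : M \subset A.
  apply/subsetP => a /MP[p pc ep]; rewrite inE.
  have := next_cycle cyc_c pc; rewrite ep /= => /joinsP[[_ eq]|[]//].
  by have := cT _ pc; rewrite ep /= => ->; rewrite -eq map_f // mem_next -ep.
have sub : U \subset [set inr (Eend a) | a in M] :|: [set inl (Vend a) | a in A :\: M].
  apply/subsetP => x; rewrite !inE => /orP[|].
    case: x => // e /mapP[p pc ep]; apply/orP; left.
    have := prev_cycle cyc_c pc; rewrite -ep => /joinsP[[eq ->]|[_ //]].
    by apply/imsetP; exists (prev c p).2 => //; apply: inM eq; rewrite mem_prev.
  case/imsetP=> a aA ->; apply/orP; right.
  have [aM|aM] := boolP (a \in M); last by apply: imset_f; rewrite inE aM.
  have [p pc ep] := MP a aM.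
  have := prev_cycle cyc_c pc; rewrite ep /= => /joinsP[[_ //]|[eq [->]]].
  have rc : prev c p \in c by rewrite mem_prev.
  move: eq; rewrite -ep => eq.
  apply/imset_f; rewrite !inE cT //= -eq map_f // andbT.
  apply/hasPn => p' p'c; apply/negP => /andP[/eqP e2].
  by rewrite (uniq_map_inj u2 p'c rc e2) eq.
have clU : eclosed T U.
  apply/eclosedP => a aT; rewrite !inE /= => /orP[ac|/imsetP[] //].
  by apply: imset_f; rewrite inE aT.
have U0 : U != set0.
  have: exists p, p \in c by case: (c) c0 => // p s _; exists p; rewrite mem_head.
  case=> p pc; apply/set0Pn.
  case ep: p.1 => [v|e]; last by exists (inr e); rewrite !inE -ep map_f.
  have /(subsetP MA) := inM _ _ pc ep; rewrite inE => /andP[_ eU].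
  by exists (inr (Eend p.2)); rewrite !inE eU.
have := sp U U0 clU; rewrite esum_degE.
have -> : [set a in T | inr (Eend a) \in U] = A.
  apply/setP => a; rewrite !inE; case: (a \in T) => //=.
  by apply: orb_idr => /imsetP[].
rewrite ltnNge => /negP; apply.
apply: leq_trans (subset_leq_card sub) _.
apply: leq_trans (leq_card_setU _ _) _.
have := leq_imset_card (fun a => inr (Eend a) : vertex G) (mem M).
have := leq_imset_card (fun a => inl (Vend a) : vertex G) (mem (A :\: M)).
have := cardsID M A; rewrite (setIidPr MA) => <- h1 h2.
exact: leq_add.
Qed.

(** If T is minimal, each edge a at e is needed: some set U_a that contains e is
closed once a is removed, and becomes tight when the V-end of a is added.  In
the least tight set M through e, the edges at e have distinct V-ends, and no
other edge from M reaches them.  Removing e and these V-ends from M leaves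
a closed set, whose sparseness bounds the degree of e. *)
Lemma sparse_minimal_degE T z : sparse T z ->
  (forall a, a \in T -> ~~ sparse (T :\ a) z) -> degE T =1 z.
Proof.
move=> spT minT e; apply/eqP; rewrite eqn_leq (sparse_le_degE _ spT) andbT.
move/sparseP: (spT) => sp.
pose A := [set a in T | Eend a == e].
have drop a : a \in A -> exists U, [/\ inr e \in U, eclosed (T :\ a) U,
     inl (Vend a) \notin U & tight T z (inl (Vend a) |: U)].
  rewrite inE => /andP[aT /eqP Ea].
  have /forallPn[U] := minT a aT; rewrite negb_imply -leqNgt => /andP[/andP[U0 clU] le].
  have clT : eclosed T (inl (Vend a) |: U).
    apply/eclosedP => b bT; rewrite !inE /= => bU.
    have [-> |ba] := eqVneq b a; first by rewrite eqxx.
    by rewrite (eclosedP _ _ clU b) ?orbT // !inE ba.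
  have aU : inl (Vend a) \notin U.
    apply: contraL le => aU; rewrite -ltnNge; apply: sp => //.
    by move: clT; rewrite (setUidPr _) // sub1set.
  have n0 : inl (Vend a) |: U != set0 by apply/set0Pn; exists (inl (Vend a)); rewrite setU11.
  have := sp _ n0 clT; rewrite esum_out cardsU1 aU add1n ltnS => le'.
  have eU : inr e \in U.
    apply: contraLR le => eU; rewrite -ltnNge; apply: sp => //.
    apply/eclosedP => b bT bU; apply: (eclosedP _ _ clU) => //.
    by rewrite !inE bT andbT; apply: contraNneq eU => ba; rewrite -Ea -ba.
  exists U; split=> //; rewrite /tight n0 clT esum_out cardsU1 aU.
  by apply/eqP; lia.
rewrite -[degE T e]/(#|A|).
have [->|/set0Pn[a0 a0A]] := eqVneq A set0; first by rewrite cards0.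
have [U0 [eU0 _ _ tU0]] := drop _ a0A.
have [M [tM eM minM]] := tight_least spT tU0 (setU1r _ eU0).
have [M0 clM /eqP zM] := and3P tM.
pose v (a : edge G) : vertex G := inl (Vend a).
have injv : {in A &, injective v}.
  move=> a b aA bA; rewrite /v => -[eqv]; apply/eqP; apply: contraT => ab.
  have [U [eU clU aU _]] := drop a aA.
  case/negP: aU; rewrite eqv; move: bA; rewrite inE => /andP[bT /eqP Eb].
  by apply: (eclosedP _ _ clU); rewrite ?Eb // !inE eq_sym ab.
have vM : v @: A \subset M :\ inr e.
  apply/subsetP => x /imsetP[a]; rewrite inE => /andP[aT /eqP Ea] ->.
  by rewrite !inE (eclosedP _ _ clM) // Ea.
pose M' := (M :\ inr e) :\: v @: A.
have cM' : #|M'| + #|A| + 1 = #|M|.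
  rewrite (cardsD1 (inr e) M) eM -(cardsID (v @: A) (M :\ inr e)) (setIidPr vM).
  by rewrite card_in_imset // -/M' addnC [#|M'| + _]addnC.
have zM' : esum z M = z e + esum z M'.
  rewrite (esumD1 _ eM); congr (_ + _); apply: eq_bigl => u; rewrite !inE.
  by case: imsetP => // -[].
have clM' : eclosed T M'.
  apply/eclosedP => b bT; rewrite !inE /= => /and3P[_ be bM].
  rewrite (eclosedP _ _ clM) // andbT; apply/imsetP => -[a aA [eqv]].
  have [U [eU clU aU tU]] := drop a aA; case/negP: aU; rewrite -eqv.
  have /subsetP sub := minM _ tU (setU1r _ eU).
  apply: (eclosedP _ _ clU); last by have := sub _ bM; rewrite !inE.
  rewrite !inE bT andbT; apply: contraNneq be => ->.
  by move: aA; rewrite inE => /andP[_ /eqP->].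
have [M'0|/sp/(_ clM')] := eqVneq M' set0; last lia.
have : esum z M' = 0 by apply: big1 => u; rewrite M'0 inE.
by move: zM' cM'; rewrite M'0 cards0; lia.
Qed.

Lemma base_spanning_tree z : base z ->
  exists2 T : {set edge G}, spanning_tree T & degE T =1 z.
Proof.
move=> /andP[sp /eqP sumz].
have [T /minsetP[spT minT] _] := minset_exists (P := fun T => sparse T z) sp.
have degT : degE T =1 z.
  apply: sparse_minimal_degE spT _ => a aT; apply/negP => spa.
  by have := minT _ spa (subsetDl _ _) => eqT; move: aT; rewrite -eqT !inE eqxx.
exists T => //; apply/andP; split.
  have /connected_indecomposable conn := sparse_indecomposable spT sumz.
  by apply/forallP => x; apply/forallP => y; apply: conn.
by apply: sparse_acyclic; rewrite (eq_sparse _ degT).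
Qed.

(** A path of vertices spelled out as the vertex-edge list that [is_cycle]
expects; the last vertex is paired with a given edge [a], to be used to close
the cycle.  The final clause is there for the induction: it shows that the edge
at the head does not recur. *)
Lemma path_edges T (x : vertex G) p a : path (adj T) x p -> uniq (x :: p) ->
  exists b c, [/\ [seq q.1 | q <- (x, b) :: c] = x :: p,
    path (fun p q => joins p.2 p.1 q.1) (x, b) c,
    (last (x, b) c).2 = a,
    all (fun q => q.2 \in T) (belast (x, b) c) &
    uniq [seq q.2 | q <- belast (x, b) c] /\
    all (fun q => (inl (Vend q.2) \in x :: p) && (inr (Eend q.2) \in x :: p))
        (belast (x, b) c)].
Proof.
elim: p x => [|y p IH] x; first by exists a, [::].
rewrite [path _ _ _]/= [uniq _]/= => /andP[/exists_inP[b bT jb] pth] /andP[xp up].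
have [b1 [c1 [e1 p1 l1 T1 [u1 V1]]]] := IH y pth up.
exists b, ((y, b1) :: c1).
have ends : ((inl (Vend b) == x) || (inr (Eend b) == x)).
  by case: (joinsP jb) => -[-> _]; rewrite eqxx ?orbT.
have ends' : (inl (Vend b) \in [:: x, y & p]) && (inr (Eend b) \in [:: x, y & p]).
  by case: (joinsP jb) => -[-> ->]; rewrite !inE !eqxx ?orbT.
split=> //.
- by rewrite -e1.
- by rewrite /= jb.
- by rewrite /= bT.
split; last first.
  rewrite [all _ _]/= ends' /=; apply/allP => q /(allP V1) /andP[h1 h2].
  by rewrite in_cons h1 orbT in_cons h2 orbT.
rewrite [map _ _]/= cons_uniq u1 andbT; apply: contra xp => /mapP[q /(allP V1)] /andP[h1 h2] /= eqb.
by case/orP: ends => /eqP<-; rewrite eqb.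
Qed.

Lemma acyclic_bridge T a : acyclic T -> a \in T ->
  ~~ connect (adj (T :\ a)) (inl (Vend a)) (inr (Eend a)).
Proof.
move=> /acyclicP noc aT; apply/negP => /connectP[p0 pth0 last0].
case/shortenP: pth0 last0 => p pth up _ lastp.
have [b [c [e1 p1 l1 T1 [u1 _]]]] := path_edges a pth up.
have cyc : is_cycle ((inl (Vend a), b) :: c).
  apply/and4P; split=> //; last 2 first.
  - by rewrite e1.
  - rewrite lastI map_rcons rcons_uniq u1 andbT l1; apply/mapP => -[q qc eqa].
    by have := allP T1 q qc; rewrite -eqa !inE eqxx.
  rewrite /cycle rcons_path p1 l1 /=.
  (* The list is closed up by the edge a, which joins the ends of the path. *)
  have -> : (last (inl (Vend a), b) c).1 = last (inl (Vend a)) p.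
    by rewrite -[LHS](last_map (fun q => q.1)); case: e1 => <-.
  by rewrite -lastp /joins !eqxx orbT.
case/negP: (noc _ cyc); rewrite lastI all_rcons l1 aT /=.
by apply/allP => q /(allP T1); rewrite inE => /andP[].
Qed.

(** Root the tree at a vertex r of U.  Sending each edge with E-end in U to its
end that is farther from r is injective, stays in the closed set U and misses
r. *)
Lemma acyclic_esum_degE T U : spanning_tree T -> U != set0 -> eclosed T U ->
  esum (degE T) U < #|U|.
Proof.
case/andP=> conn acyc /set0Pn[r rU] clU.
have {conn} /connected_indecomposable ind : forall x y, connect (adj T) x y.
  by move=> x y; have /forallP/(_ x)/forallP/(_ y) := conn.
rewrite esum_degE; set A := [set a in T | _].
(* The far end of a is the one that removing a cuts off from the root. *)
pose C a := component (T :\ a) r.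
pose far (a : edge G) : vertex G :=
  if inl (Vend a) \in C a then inr (Eend a) else inl (Vend a).
pose near (a : edge G) : vertex G :=
  if inl (Vend a) \in C a then inl (Vend a) else inr (Eend a).
have farC a : a \in T -> far a \notin C a.
  move=> aT; rewrite /far; case: ifPn => // vC; apply/negP; move: vC.
  rewrite !inE => rv re; case/negP: (acyclic_bridge acyc aT).
  by rewrite (same_connect (adj_sym _) (_ : connect _ _ r)) // adj_sym.
have nearC a : a \in T -> near a \in C a.
  move=> aT; rewrite /near; case: ifPn => // vC; apply: contraT => eC.
  have CT : C a = setT.
    apply: ind; first by apply/set0Pn; exists r; apply: component_refl.
    move=> b bT; have [->|ba] := eqVneq b a; first by rewrite (negbTE vC) (negbTE eC).
    by apply: component_edge; rewrite !inE ba.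
  by rewrite CT inE in vC.
have ends a : (far a, near a) = (inl (Vend a), inr (Eend a)) \/
              (far a, near a) = (inr (Eend a), inl (Vend a)).
  by rewrite /far /near; case: ifP; [right | left].
have nearE a b : a \in T -> b \in T -> a != b -> (near a \in C b) = (far a \in C b).
  move=> aT bT ab; have := component_edge r (_ : a \in T :\ b).
  by rewrite !inE ab => /(_ aT); case: (ends a) => -[-> ->].
have injfar : {in A &, injective far}.
  move=> a b; rewrite !inE => /andP[aT _] /andP[bT _] eqf; apply/eqP.
  apply: contraT => ab.
  (* If a and b have the same far end, none of their ends is reached from r
     when both are removed; then restoring a does not help to reach b. *)
  pose K := component (T :\ a :\ b) r.
  have KCa : K \subset C a by apply: componentS; apply: subsetDl.
  have KCb : K \subset C b by apply: componentS; apply: setSD; apply: subsetDl.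
  have naK : near a \notin K.
    by apply: contra (farC b bT) => /(subsetP KCb); rewrite nearE // eqf.
  have faK : far a \notin K.
    by apply: contra (farC a aT) => /(subsetP KCa).
  have /subsetP CbK : C b \subset K.
    apply: component_min (component_refl _ _) _ => d /setD1P[db dT].
    have [->|da] := eqVneq d a; last first.
      by rewrite /K; apply: component_edge; rewrite !inE da db.
    by case: (ends a) naK faK => -[-> ->] /negbTE-> /negbTE->.
  have := farC a aT; rewrite eqf -nearE // 1?eq_sym //.
  by rewrite (subsetP KCa) // CbK // nearC.
rewrite -(card_in_imset injfar); apply: proper_card; apply/properP; split.
  apply/subsetP => x /imsetP[a]; rewrite inE => /andP[aT eU] ->.
  by rewrite /far; case: ifP => // _; apply: (eclosedP _ _ clU).
exists r => //; apply/imsetP => -[a]; rewrite inE => /andP[aT _] er.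
by have := farC a aT; rewrite -er component_refl.
Qed.

(** A set of vertices grown from one vertex along edges of T gains an inner edge
with each new vertex, and connectedness lets it grow to everything. *)
Lemma indecomposable_card T : indecomposable T -> #|vertex G| <= #|T|.+1.
Proof.
move=> ind; have [r _|] := pickP (mem [set: vertex G]); last first.
  by move=> no; rewrite -cardsT eq_card0.
pose E (U : {set vertex G}) := [set a in T | (inl (Vend a) \in U) && (inr (Eend a) \in U)].
pose P (U : {set vertex G}) := (r \in U) && (#|U| <= #|E U|.+1).
have Pr : P [set r] by rewrite /P set11 cards1.
case: (@arg_maxnP _ [set r] P (fun U => #|U|) Pr) => U /andP[rU le] maxU.
suff UT : U = setT.
  rewrite -cardsT -UT; apply: leq_trans le _; rewrite ltnS; apply: subset_leq_card.
  by apply/subsetP => a; rewrite inE => /andP[].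
apply: ind => [|a aT]; first by apply/set0Pn; exists r.
apply/eqP; apply: contraT => cross.
have [x [xU xa]] : exists x, x \notin U /\ (a \in E (x |: U)).
  move: cross; rewrite /E.
  have [vU|vU] := boolP (inl (Vend a) \in U);
    have [eU|eU] := boolP (inr (Eend a) \in U) => //= _.
  - by exists (inr (Eend a)); rewrite !inE aT vU eqxx orbT.
  - by exists (inl (Vend a)); rewrite !inE aT eU eqxx !orbT.
have aE : a \notin E U.
  by move: cross; rewrite !inE; case: (_ \in U); case: (_ \in U); rewrite ?andbF.
have : P (x |: U).
  rewrite /P setU1r //= cardsU1 xU add1n ltnS; apply: leq_trans le _.
  have <- : #|a |: E U| = #|E U|.+1 by rewrite cardsU1 aE.
  apply: subset_leq_card; apply/subsetP => b /setU1P[->//|].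
  by rewrite !inE => /and3P[-> -> ->]; rewrite !orbT.
by move/maxU; rewrite cardsU1 xU /= ltnn.
Qed.

Lemma spanning_tree_base T : 0 < #|vertex G| -> spanning_tree T -> base (degE T).
Proof.
move=> n0 tT; have spT : sparse T (degE T).
  by apply/sparseP => U; apply: acyclic_esum_degE.
have sp := sparseS (subsetT T) spT.
rewrite /base sp eqn_leq (sum_base sp n0) /=.
have -> : \sum_e degE T e = #|T|.
  by rewrite -esum_setT esum_degE; apply: eq_card => a; rewrite !inE andbT.
apply: indecomposable_card; apply/connected_indecomposable => x y.
by case/andP: tT => /forallP/(_ x)/forallP/(_ y).
Qed.

Lemma hypertree_base (f : Eclass G -> nat) : 0 < #|vertex G| ->
  hypertree f = base (fun e => (f e).+1).
Proof.
move=> n0; apply/existsP/idP => [[T /andP[tT /forallP deg]]|bf].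
  have eqd : degE T =1 (fun e => (f e).+1) by move=> e; apply/eqP.
  have := spanning_tree_base n0 tT; rewrite /base (eq_sparse _ eqd).
  by under eq_bigr do rewrite eqd.
have [T tT deg] := base_spanning_tree bf; exists T; rewrite tT.
by apply/forallP => e; rewrite deg.
Qed.
End Trees.

(** * Cancellation along an alternating cycle *)

Section Chains.
Variable X : finType.

Definition toggle (K : X) (W : {set X}) := if K \in W then W :\ K else K |: W.

Lemma in_toggle K W U : (U \in toggle K W) = if U == K then K \notin W else U \in W.
Proof.
rewrite /toggle; case: ifP => KW; rewrite !inE; case: eqP => //= ->; by rewrite KW.
Qed.

Lemma toggleK K : involutive (toggle K).
Proof.
move=> W; apply/setP => U; rewrite !in_toggle eqxx negbK.
by case: eqP => [->|].
Qed.

Lemma sign_toggle K W : ((-1) ^+ #|toggle K W| = - (-1) ^+ #|W| :> int)%R.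
Proof.
rewrite /toggle; case: ifP => KW; last by rewrite cardsU1 KW exprS mulN1r.
by rewrite [in RHS](cardsD1 K) KW exprS mulN1r opprK.
Qed.

(** A sign reversing involution: [k] selects the element to be toggled, and the
toggle does not affect the selection. *)
Lemma toggle_sum0 (P : pred {set X}) (k : {set X} -> X) :
    (forall W, P W -> P (toggle (k W) W) && (k (toggle (k W) W) == k W)) ->
  (\sum_(W | P W) (-1) ^+ #|W| = 0 :> int)%R.
Proof.
move=> Pk; pose h W := toggle (k W) W.
have hK W : P W -> h (h W) = W.
  by move=> /Pk/andP[_ /eqP kW]; rewrite {1}/h kW toggleK.
set s := (\sum_(W | _) _)%R; suff : (s = - s)%R by lia.
rewrite {1}/s (reindex_onto h h) // -sumrN; apply: eq_big => W.
  apply/andP/idP => [[PhW /eqP <-]|PW]; first by case/andP: (Pk _ PhW).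
  by rewrite hK // eqxx; case/andP: (Pk _ PW).
by rewrite sign_toggle.
Qed.
End Chains.

Section ChainsOfSets.
Variable X : finType.

Definition chain (W : {set {set X}}) :=
  [forall U in W, forall U' in W, (U \subset U') || (U' \subset U)].

Lemma chainP (W : {set {set X}}) : reflect (forall U U', U \in W -> U' \in W -> U \subset U' \/ U' \subset U)
  (chain W).
Proof.
apply: (iffP forall_inP) => [h U U' UW U'W|h U UW].
  by apply/orP; move/forall_inP: (h U UW); apply.
by apply/forall_inP => U' U'W; apply/orP; apply: h.
Qed.

(** The poset Q is contractible through U <= U :|: U0 >= U0, so its order complex,
with the empty chain included, has Euler characteristic zero.  Explicitly, toggle
in W the set M :|: U0, where M is the union (that is, the largest) of the members
of W not containing U0. *)
Lemma chain_sum0 (Q : pred {set X}) (U0 : {set X}) :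
    Q U0 -> (forall U, Q U -> Q (U :|: U0)) ->
  (\sum_(W : {set {set X}} | chain W && (W \subset Q)) (-1) ^+ #|W| = 0 :> int)%R.
Proof.
move=> QU0 QU.
(* The toggled set m W :|: U0 contains U0, so m W stays the same. *)
pose m (W : {set {set X}}) := \bigcup_(U in W | ~~ (U0 \subset U)) U.
pose k (W : {set {set X}}) : {set X} := m W :|: U0.
apply: (toggle_sum0 (k := k)) => W /andP[/chainP chW /subsetP WQ].
rewrite /k; set K := m W :|: U0.
have mt : m (toggle K W) = m W.
  apply: eq_bigl => U; rewrite in_toggle; case: eqP => [->|//].
  by rewrite subsetUr !andbF.
have mW : m W = set0 \/ (m W \in W) && ~~ (U0 \subset m W).
  have [/exists_inP[U1 U1W U01]|/exists_inPn no] :=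
    boolP [exists U in W, ~~ (U0 \subset U)]; last first.
    left; apply: big1 => U /andP[UW]; move: (no U UW); rewrite negbK => -> //.
  right; pose P1 U := (U \in W) && ~~ (U0 \subset U).
  have P1U1 : P1 U1 by rewrite /P1 U1W.
  case: (@arg_maxnP _ U1 P1 (fun U => #|U|) P1U1) => M /andP[MW U0M] maxM.
  suff -> : m W = M by rewrite MW.
  apply/eqP; rewrite eqEsubset; apply/andP; split; last first.
    by apply: (bigcup_max M); rewrite ?MW.
  apply/bigcupsP => U /andP[UW U0U].
  have [//|MU] := chW U M UW MW.
  have /eqP<- // : M == U.
  by rewrite eqEcard MU; apply: maxM; rewrite /P1 UW.
have QK : Q K.
  case: mW => [mW0|/andP[mW _]]; first by rewrite /K mW0 set0U.
  by apply: QU; apply: WQ.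
have cmp U : U \in W -> U \subset K \/ K \subset U.
  move=> UW; have [U0U|U0U] := boolP (U0 \subset U); last first.
    left; apply: subset_trans (subsetUl _ _).
    by apply: (bigcup_max U) => //; rewrite UW.
  case: mW => [mW0|/andP[mW mU0]].
    by right; rewrite /K mW0 set0U.
  have [UM|MU] := chW U (m W) UW mW; last by right; rewrite subUset MU U0U.
  by rewrite (subset_trans U0U UM) in mU0.
rewrite mt eqxx andbT; apply/andP; split.
  apply/chainP => U U'; rewrite !in_toggle.
  case: eqP => [->|_]; case: eqP => [->|_]; first by left.
  - by move=> _ /cmp[]; [right | left].
  - by move=> /cmp.
  - exact: chW.
apply/subsetP => U; rewrite in_toggle; case: eqP => [-> _ //|_]; exact: WQ.
Qed.
End ChainsOfSets.

Section SparseChains.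
Variable G : bigraph.
Implicit Types (T : {set edge G}) (U : {set vertex G}) (z : Eclass G -> nat).

Definition overfull z U := (U != set0) && (#|U| <= esum z U).

(** When overfull closed sets exist, let U0 maximize the excess z(U) - #|U|.  The
union of U0 with an overfull closed set U is overfull: the excess is modular,
and that of U :&: U0 is at most that of U0, whether or not U :&: U0 is empty. *)
Lemma sparse_chains T z :
  ((sparse T z)%:R = \sum_(W : {set {set vertex G}} |
     chain W && (W \subset [pred U | overfull z U && eclosed T U])) (-1) ^+ #|W| :> int)%R.
Proof.
set Q := [pred U | _].
have [sp|] := boolP (sparse T z).
  have Q0 U : ~~ Q U.
    apply/negP => /andP[/andP[U0 le] clU]; move/sparseP: sp => /(_ U U0 clU).
    by rewrite ltnNge le.
  rewrite (big_pred1 set0) ?cards0 // => W; apply/andP/eqP => [[_ /subsetP sub]|->].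
    by apply/setP => U; rewrite inE; apply/negP => /sub; apply/negP; apply: Q0.
  split; last by apply/subsetP => U; rewrite inE.
  by apply/chainP => U U'; rewrite inE.
move=> nsp.
have [U1 QU1] : exists U, Q U.
  case/forallPn: nsp => U; rewrite negb_imply -leqNgt => /andP[/andP[U0 clU] le].
  by exists U; rewrite /= /overfull U0 le.
(* The complement replaces - #|U| to stay within natural numbers. *)
have [U0 QU0 maxU] : exists2 U0 : {set vertex G}, Q U0 &
    forall U : {set vertex G}, Q U -> esum z U + #|~: U| <= esum z U0 + #|~: U0|.
  case: (@arg_maxnP _ U1 Q (fun U => esum z U + #|~: U|) QU1) => U0 QU0 maxU.
  by exists U0.
rewrite (@chain_sum0 _ Q U0) // => U QU.
case/andP: QU (QU) => /andP[Un0 Ule] Ucl QU.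
case/andP: QU0 => /andP[U0n0 U0le] U0cl.
have Xn0 : U :|: U0 != set0.
  by apply: contraNneq Un0 => X0; rewrite -subset0 -X0 subsetUl.
apply/andP; split; last exact: eclosedU.
rewrite /overfull Xn0.
have cI : esum z (U :&: U0) + #|U0| <= esum z U0 + #|U :&: U0|.
  have [->|In0] := eqVneq (U :&: U0) set0.
    have -> : esum z set0 = 0 by apply: big1 => e; rewrite inE.
    by rewrite cards0 addn0.
  have [le|lt] := leqP #|U :&: U0| (esum z (U :&: U0)); last by lia.
  have QI : Q (U :&: U0) by rewrite /= /overfull In0 le eclosedI.
  by have := maxU _ QI; have := cardsC U0; have := cardsC (U :&: U0); lia.
have := esumUI z U U0; have := cardsUI U U0; lia.
Qed.
End SparseChains.

Lemma sparse_delete (G : bigraph) (S : {set edge G}) (z : Eclass G -> nat) :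
  @sparse (delete_edges S) setT z = @sparse G (~: S) z.
Proof.
apply: eq_forallb => U; congr (_ && _ ==> _).
apply/eclosedP/eclosedP => cl a aS.
  have aS' : a \notin S by rewrite inE in aS.
  exact: (cl (exist _ a aS')).
by apply: cl; rewrite inE (valP a).
Qed.

Section Alternating.
Variable G : signed_bigraph.

(** Whether an edge of the cycle is positive and whether it is traversed from V
to E change at every step, hence whether p goes weakly up or weakly down is the
same for all steps. *)
Lemma alternating_no_potential (c : seq (vertex G * edge G)) (p : vertex G -> nat) :
    alternating_cycle c ->
    (forall a, a \notin neg_edges G -> p (inr (Eend a)) <= p (inl (Vend a))) ->
    (forall a, a \in neg_edges G -> p (inl (Vend a)) < p (inr (Eend a))) ->
  False.
Proof.
case/andP=> /and4P[c0 cyc u1 _] alt pos neg; have uc := map_uniq u1.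
pose isl (q : vertex G * edge G) := if q.1 is inl _ then true else false.
(* t tells whether p weakly decreases along the step; it is constant on c. *)
pose t q := isl q (+) (q.2 \in neg_edges G).
have next_joins q : q \in c -> joins q.2 q.1 (next c q).1.
  by move=> qc; apply: next_cycle cyc qc.
have t_next q : q \in c -> t q = t (next c q).
  move=> qc; have := next_cycle alt qc; rewrite /t /isl.
  by case/joinsP: (next_joins q qc) => -[-> ->] /=;
    case: (_ \in _); case: (_ \in _).
have all_t q q' : q \in c -> q' \in c -> t q = t q'.
  have tr : transitive (fun q q' => t q == t q') by move=> y x w /eqP->.
  have : cycle (fun q q' => t q == t q') c.
    by apply: cycle_from_next => // x xc; apply/eqP; apply: t_next.
  by rewrite (cycle_all2rel tr) => /allrelP h qc q'c; apply/eqP; apply: h.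
have all_p q q' : q \in c -> q' \in c -> p q.1 = p q'.1.
  pose le (q q' : vertex G * edge G) := p q.1 <= p q'.1.
  have le_tr : transitive le.
    by move=> y x w; apply: leq_trans.
  pose ge (q q' : vertex G * edge G) := p q'.1 <= p q.1.
  have ge_tr : transitive ge.
    by move=> y x w /[swap]; apply: leq_trans.
  have [q0 q0c] : exists q0, q0 \in c by case: (c) c0 => // x s; exists x; rewrite mem_head.
  have step x : x \in c ->
      if t q0 then p (next c x).1 <= p x.1 else p x.1 <= p (next c x).1.
    move=> xc; rewrite (all_t q0 x) // /t /isl.
    by case/joinsP: (next_joins x xc) => -[-> ->] /=;
      have [/neg/ltnW|/pos] := boolP (x.2 \in _).
  move=> qc q'c; apply/eqP; rewrite eqn_leq.
  case: (t q0) step => step.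
    have : all2rel ge c by rewrite -(cycle_all2rel ge_tr); apply: cycle_from_next.
    move/allrelP=> h.
    by apply/andP; split; apply: h.
  have : all2rel le c by rewrite -(cycle_all2rel le_tr); apply: cycle_from_next.
    move/allrelP=> h.
  by apply/andP; split; apply: h.
have [q qc qneg] : exists2 q, q \in c & q.2 \in neg_edges G.
  have [q0 q0c] : exists q0, q0 \in c by case: (c) c0 => // x s; exists x; rewrite mem_head.
  have [?|q0n] := boolP (q0.2 \in neg_edges G); first by exists q0.
  exists (next c q0); first by rewrite mem_next.
  by have := next_cycle alt q0c; rewrite (negbTE q0n); case: (_ \in _).
have := neg _ qneg; have nc : next c q \in c by rewrite mem_next.
by case/joinsP: (next_joins q qc) => -[<- <-]; rewrite (all_p _ _ qc nc) ltnn.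
Qed.

(** After exchanging the sums, the inner sum over S runs over the sets between the
edges violated by a chain W and the negative edges.  It cancels by toggling any
negative edge that is not violated; if all are violated, and the range is not
empty, counting the members of W through a vertex contradicts
[alternating_no_potential]. *)
Lemma alternating_sparse_sum0 (c : seq (vertex G * edge G)) (z : Eclass G -> nat) :
    alternating_cycle c ->
  (\sum_(S : {set edge G} | S \subset neg_edges G)
     (-1) ^+ #|S| * (sparse (~: S) z)%:R = 0 :> int)%R.
Proof.
move=> altc.
under eq_bigr do rewrite sparse_chains mulr_sumr.
rewrite (exchange_big_dep (fun W : {set {set vertex G}} => chain W)) /=; last first.
  by move=> S W _ /andP[].
apply: big1 => W /chainP chW; rewrite -mulr_suml.
pose viol := [set a : edge G | [exists U in W, (inr (Eend a) \in U) && (inl (Vend a) \notin U)]].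
have violN a U : a \notin viol -> U \in W -> inr (Eend a) \in U -> inl (Vend a) \in U.
  rewrite inE => /exists_inPn h /h; rewrite negb_and negbK.
  by case/orP=> // /negP.
pose P (S : {set edge G}) := [&& S \subset neg_edges G, chain W &
  W \subset [pred U | overfull z U && eclosed (~: S) U]].
have [nv|/subsetPn[a aneg av]] := boolP (neg_edges G \subset viol).
  rewrite big1 ?mul0r // => S /and3P[Sneg _ /subsetP WQ].
  have violS : viol \subset S.
    apply/subsetP => a; rewrite inE => /exists_inP[U UW /andP[eU vU]].
    have /andP[_ /eclosedP clU] := WQ U UW.
    by apply: contraR vU => aS; apply: clU; rewrite // inE.
  have violE : viol = neg_edges G.
    by apply/eqP; rewrite eqEsubset nv (subset_trans violS).
  exfalso; apply: (@alternating_no_potential c (fun x => #|[set U in W | x \in U]|) altc).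
    move=> a aneg; apply: subset_leq_card; apply/subsetP => U; rewrite !inE.
    by case/andP=> UW eU; rewrite UW (violN a) // violE.
  move=> a; rewrite -violE inE => /exists_inP[U UW /andP[eU vU]].
  apply: proper_card; apply/properP; split; last first.
    by exists U; rewrite !inE UW.
  apply/subsetP => U'; rewrite !inE => /andP[U'W vU']; rewrite U'W /=.
  have [/subsetP UU'|/subsetP UU'] := chW U U' UW U'W; first exact: UU'.
  by rewrite (UU' _ vU') in vU.
rewrite (@toggle_sum0 _ P (fun _ => a)) ?mul0r // => S.
have PE S' : P S' = [&& S' \subset neg_edges G, W \subset overfull z & viol \subset S'].
  rewrite /P; congr (_ && _); have /chainP -> /= := chW.
  apply/subsetP/andP => [h|[/subsetP h1 /subsetP h2] U UW].
    split; first by apply/subsetP => U /h /andP[].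
    apply/subsetP => b; rewrite inE => /exists_inP[U UW /andP[eU vU]].
    have /andP[_ /eclosedP clU] := h U UW.
    by apply: contraR vU => aS; apply: clU; rewrite // inE.
  apply/andP; split; first exact: h1.
  apply/eclosedP => b; rewrite inE => bS.
  by apply: violN UW; apply: contra bS => /h2.
rewrite eqxx andbT !PE => /and3P[/subsetP Sneg -> /subsetP violS] /=.
apply/andP; split; apply/subsetP => b.
  by rewrite in_toggle; case: eqP => [-> //|_]; apply: Sneg.
move=> bv; rewrite in_toggle; case: eqP => [eb|_]; last exact: violS.
by rewrite eb (negbTE av) in bv.
Qed.
End Alternating.

Local Open Scope ring_scope.

(** * The interior polynomial of a connected graph *)

(** The contribution of z to I'_G(1 - x); [n] will be the number of vertices. *)
Definition weight (I : finType) n (z : I -> nat) : {poly int} :=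
  'X^(n.-1 - \sum_i z i) * (1 - 'X) ^+ #|[set i | 0 < z i]%N|.

(** The sum telescopes: it is x^g + (1 - x) (1 + x + ... + x^(g-1)). *)
Lemma sum_slice b g : (g <= b)%N ->
  \sum_(i < b.+1 | (i <= g)%N) 'X^(g - i) * (1 - 'X) ^+ (0 < i)%N = 1 :> {poly int}.
Proof.
move=> gb.
have <- := big_ord_widen_cond b.+1 xpredT
  (fun i => 'X^(g - i) * (1 - 'X) ^+ (0 < i)%N : {poly int}) (gb : g < b.+1)%N.
elim: g {gb} => [|g IH]; first by rewrite big_ord_recr big_ord0 /= !expr0 mulr1 add0r.
rewrite big_ord_recr /= subnn expr0 expr1 mul1r.
under eq_bigr => i _ do rewrite subSn ?exprS -?mulrA -1?ltnS //.
by rewrite -mulr_sumr IH mulr1 addrC subrK.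
Qed.

Lemma weight_prod (I : finType) n (g z : I -> nat) :
    (\sum_i g i = n.-1)%N -> (forall i, z i <= g i)%N ->
  \prod_i ('X^(g i - z i) * (1 - 'X) ^+ (0 < z i)%N) = weight n z.
Proof.
move=> gn zg; rewrite big_split /= -!expr_sum; congr (_ ^+ _ * _ ^+ _).
  apply/eqP; rewrite -gn -(eqn_add2r (\sum_i z i)%N) subnK; last exact: leq_sum.
  by rewrite -big_split; apply/eqP/eq_bigr => i _; rewrite /= subnK.
by rewrite -sum1_card [RHS]big_mkcond; apply: eq_bigr => i _; rewrite inE; case: ltnP.
Qed.

Section Connected.
Variables (G : bigraph) (le : rel (Eclass G)).
Hypotheses (le_total : total le) (le_anti : antisymmetric le) (le_trans : transitive le).

Local Notation sparse := (@sparse G).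
Local Notation base := (@base G).
Local Notation hypertree := (@hypertree G).

(** The vectors z attached to f.  They form a box with top f + 1, degenerate in
the inactive directions. *)
Definition fits (f z : Eclass G -> nat) :=
  [forall e, (z e <= (f e).+1)%N && (inactive le f e ==> (z e == (f e).+1))].

Local Notation height e := #|[set x | le e x]|.

(** Counting the elements above e gives early elements a larger weight. *)
Lemma height_lt e e' : le e' e -> e' != e -> (height e < height e')%N.
Proof.
move=> lee ne; apply: proper_card; apply/properP; split.
  by apply/subsetP => x; rewrite !inE; apply: le_trans.
exists e'; rewrite inE; first by have := le_total e' e'; rewrite orbb.
by apply: contra ne => ee'; apply/eqP/le_anti; rewrite lee.
Qed.

Lemma sparse_below_base z : (0 < #|Eclass G|)%N -> indecomposable (G := G) setT ->
  sparse setT z -> exists2 g, base g & forall e, (z e <= g e)%N.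
Proof.
move=> /card_gt0P[e0 _] conn.
have [m] := ubnP (#|vertex G| - \sum_e z e); elim: m z => // m IH z; rewrite ltnS => lem sp.
have [/existsP[e spe]|/existsPn maxz] := boolP [exists e, sparse setT (incr z e)].
  have n0 : (0 < #|vertex G|)%N by apply/card_gt0P; exists (inr e).
  have lt := sum_base spe n0.
  have sumi : (\sum_u incr z e u = (\sum_u z u).+1)%N.
    by rewrite -!esum_setT esum_incr inE addn1.
  have [||g bg leg] := IH (incr z e); rewrite ?spe //; first by lia.
  by exists g => // u; apply: leq_trans (leg u); rewrite leq_addr.
by exists z => //; apply: maximal_sparse_base e0 z conn sp maxz.
Qed.

(** Among the hypertrees f with z <= f + 1 take one of maximal total weight.  If e
is inactive and z e <= f e, transferring one unit from e to some e' < e keeps f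
above z and increases the weight. *)
Lemma fits_exists z : (0 < #|Eclass G|)%N -> (1 < #|vertex G|)%N ->
    indecomposable (G := G) setT -> sparse setT z ->
  exists f : {ffun Eclass G -> 'I_#|edge G|},
    hypertree (fun e => f e : nat) && fits (fun e => f e : nat) z.
Proof.
move=> E0 n1 conn sp; have n0 := ltnW n1.
have [g bg leg] := sparse_below_base E0 conn sp.
have hf (f : Eclass G -> nat) : hypertree f -> (forall e, z e <= (f e).+1)%N ->
    exists2 f' : {ffun Eclass G -> 'I_#|edge G|}, (fun e => f' e : nat) =1 f &
      hypertree (fun e => f' e : nat) && [forall e, (z e <= (f' e).+1)%N].
  move=> hf lef; pose f' := [ffun e => Ordinal (hypertree_lt e hf)].
  have eqf : (fun e => f' e : nat) =1 f by move=> e; rewrite ffunE.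
  exists f' => //; rewrite hypertree_base // (eq_base (z' := fun e => (f e).+1)).
    by rewrite -hypertree_base // hf; apply/forallP => e; rewrite eqf.
  by move=> e; rewrite eqf.
have [||f0 _ Pf0] := hf (fun e => (g e).-1).
- by rewrite hypertree_base // (eq_base (z' := g)) // => e; rewrite prednK ?(base_gt0 _ n1).
- by move=> e; rewrite prednK ?(base_gt0 _ n1).
pose P (f : {ffun Eclass G -> 'I_#|edge G|}) :=
  hypertree (fun e => f e : nat) && [forall e, (z e <= (f e).+1)%N].
case: (@arg_maxnP _ f0 P (fun f => \sum_e f e * height e)%N Pf0) => f /andP[hyp /forallP lef] maxf.
exists f; rewrite hyp; apply/forallP => e; rewrite lef /=; apply/implyP.
case/existsP=> e' /and4P[lee ne fe0 hyp']; rewrite eqn_leq lef /= leqNgt; apply/negP => ltz.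
have ne' : e != e' by rewrite eq_sym.
have tE u := @transferE _ (fun e => f e : nat) e e' u fe0 ne'.
have [|f1 eqf1 Pf1] := hf _ hyp'.
  move=> u; have := tE u; have := lef u; case: (u =P e) => [->|_] /=; last by lia.
  by rewrite (negbTE ne'); lia.
have eqs : (\sum_u f1 u * height u + height e = \sum_u f u * height u + height e')%N.
  have sumd x : (\sum_u (u == x) * height u = height x)%N.
    by rewrite (bigD1 x) //= eqxx mul1n big1 ?addn0 // => u /negbTE->.
  rewrite -{1}(sumd e) -(sumd e') -!big_split /=; apply: eq_bigr => u _.
  by rewrite -!mulnDl -tE -eqf1.
have : (\sum_u f1 u * height u <= \sum_u f u * height u)%N := maxf f1 Pf1.
by rewrite -(leq_add2r (height e)) eqs leq_add2l leqNgt height_lt.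
Qed.

(** At the first element e' where f1 and f2 differ, with f1 smaller, exchange
produces some e > e' with f1 e > f2 e that is inactive for f1; so z attains
f1 + 1 at e, which exceeds the bound f2 + 1. *)
Lemma fits_first_difference (f1 f2 z : Eclass G -> nat) e' :
    (0 < #|vertex G|)%N -> hypertree f1 -> hypertree f2 -> fits f1 z -> fits f2 z ->
    (forall e, f1 e != f2 e -> le e' e) -> (f1 e' < f2 e')%N -> False.
Proof.
move=> n0; rewrite !hypertree_base // => b1 b2 /forallP fit1 /forallP fit2 first lt.
have [e] := base_exchange b1 b2 (lt : ((f1 e').+1 < (f2 e').+1)%N).
rewrite ltnS => lt' bt.
have ne : e != e' by apply: contraTneq lt' => ->; rewrite -leqNgt ltnW.
have f1e : (0 < f1 e)%N by apply: leq_trans lt'.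
have inact : inactive le f1 e.
  apply/existsP; exists e'; rewrite first ?(gtn_eqF lt') // eq_sym ne f1e /=.
  rewrite hypertree_base //; rewrite (eq_base (z' := transfer (fun e => (f1 e).+1) e e')) // => u.
  by rewrite /transfer; case: (u =P e) => [->|_]; lia.
have /andP[_ /implyP/(_ inact)/eqP ze] := fit1 e.
by have /andP[+ _] := fit2 e; rewrite ze; lia.
Qed.

Lemma fits_unique (f1 f2 : {ffun Eclass G -> 'I_#|edge G|}) (z : Eclass G -> nat) :
    (0 < #|vertex G|)%N ->
    hypertree (fun e => f1 e : nat) -> hypertree (fun e => f2 e : nat) ->
    fits (fun e => f1 e : nat) z -> fits (fun e => f2 e : nat) z -> f1 = f2.
Proof.
move=> n0 h1 h2 fit1 fit2; apply/eqP; apply: contraT => ne12.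
have [e0 De0] : exists e, f1 e != f2 e.
  apply/existsP; apply: contraNT ne12 => /existsPn eq12; apply/eqP/ffunP => e.
  by apply/eqP; rewrite -[_ == _]negbK.
case: (@arg_maxnP _ e0 (fun e => f1 e != f2 e) (fun e => height e) De0) => e' De' maxe'.
have first e : f1 e != f2 e -> le e' e.
  move=> De; have [->|ne] := eqVneq e e'; first by have := le_total e' e'; rewrite orbb.
  case/orP: (le_total e' e) => // lee.
  by have := maxe' e De; rewrite /= leqNgt height_lt.
exfalso; case: (ltngtP (f1 e') (f2 e')) De'.
- by move=> lt _; apply: fits_first_difference n0 h1 h2 fit1 fit2 first lt.
- move=> lt _; apply: fits_first_difference n0 h2 h1 fit2 fit1 _ lt => e.
  by rewrite eq_sym; apply: first.
- by move/val_inj=> ->; rewrite eqxx.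
Qed.

Lemma fits_sparse f z : (0 < #|vertex G|)%N -> hypertree f -> fits f z -> sparse setT z.
Proof.
move=> n0; rewrite hypertree_base // => /andP[sp _] /forallP fit.
by apply: sparse_le sp => e; case/andP: (fit e).
Qed.

(** The sum over the box factors into one sum per element of E, equal to 1 - x at
inactive elements and to 1 at active ones. *)
Lemma fits_sum b (f : Eclass G -> nat) : (#|vertex G| <= b.+1)%N ->
    (0 < #|vertex G|)%N -> hypertree f ->
  \sum_(z : {ffun Eclass G -> 'I_b.+1} | fits f (fun e => z e))
    weight #|vertex G| (fun e => z e) = (1 - 'X) ^+ #|[set e | inactive le f e]|.
Proof.
move=> nb n0; rewrite hypertree_base // => /andP[sp /eqP sumf].
have fb e : ((f e).+1 <= b)%N.
  have := leq_trans (sum_base sp n0) nb; rewrite ltnS; apply: leq_trans.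
  by rewrite (bigD1 e) //= leq_addr.
pose Q e (i : 'I_b.+1) := (i <= (f e).+1)%N && (inactive le f e ==> (i == (f e).+1 :> nat)).
pose F e (i : 'I_b.+1) : {poly int} := 'X^((f e).+1 - i) * (1 - 'X) ^+ (0 < i)%N.
transitivity (\prod_e \sum_(i | Q e i) F e i).
  rewrite bigA_distr_big_dep; apply: eq_big => [z|z /forallP fit].
    by apply/forallP/familyP => h e; have := h e.
  rewrite -(weight_prod (g := fun e => (f e).+1)) -?sumf // => e.
  by case/andP: (fit e).

have -> : #|[set e | inactive le f e]| = (\sum_e inactive le f e)%N.
  by rewrite -sum1_card big_mkcond; apply: eq_bigr => e _; rewrite inE; case: inactive.
rewrite expr_sum; apply: eq_bigr => e _; rewrite /Q /F.
case: (inactive le f e) => /=; last by under eq_bigl do rewrite andbT; apply: sum_slice.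
have fK : (inord (f e).+1 : 'I_b.+1) = (f e).+1 :> nat.
  by apply: (@inordK b (f e).+1); rewrite ltnS; apply: fb.
rewrite (big_pred1 (inord (f e).+1 : 'I_b.+1)) ?fK ?subnn ?expr0 ?mul1r //= => i.
apply/andP/eqP => [[_ /eqP ei]|->]; last by rewrite fK.
by apply: val_inj; rewrite /= fK.
Qed.

(** A single vertex needs its own argument, since the interior polynomial is then 1
by convention; only z = 0 is sparse in that case. *)
Lemma interior_poly_connected b : (#|vertex G| <= b.+1)%N ->
    (0 < #|vertex G|)%N -> indecomposable (G := G) setT ->
  interior_poly le \Po (1 - 'X) =
  \sum_(z : {ffun Eclass G -> 'I_b.+1} | sparse setT (fun e => z e))
    weight #|vertex G| (fun e => z e).
Proof.
move=> nb n0 conn; rewrite /interior_poly; case: eqP => [n1|/eqP n1].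
  rewrite comp_polyC (big_pred1 [ffun=> ord0]) => [|z].
    rewrite /weight n1 sub0n expr0 mul1r -[LHS](expr0 (1 - 'X)); congr (_ ^+ _).
    by apply/esym/eqP; rewrite cards_eq0; apply/eqP/setP => e; rewrite !inE ffunE.
  apply/idP/eqP => [sp|->].
    apply/ffunP => e; apply: val_inj; rewrite ffunE /=.
    by have := sum_base sp n0; rewrite n1 (bigD1 e) //=; case: (nat_of_ord _).
  apply/sparseP => U U0 _; rewrite /esum big1 ?card_gt0 // => e _.
  by rewrite ffunE.
have n1' : (1 < #|vertex G|)%N by case: #|_| n0 n1 => [|[]].
have E0 : (0 < #|Eclass G|)%N.
  rewrite lt0n; apply: contra n1 => /eqP E0.
  have noE (e : Eclass G) : False by have := fintype0 e; apply.
  have /card_gt0P[x _] := n0.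
  have -> : #|vertex G| = #|[set x]|; last by rewrite cards1.
  rewrite -cardsT (conn [set x]) //; first by apply/set0Pn; exists x; rewrite inE.
  by move=> a; case: (noE (Eend a)).
rewrite raddf_sum /=.
transitivity (\sum_(f : {ffun Eclass G -> 'I_#|edge G|} | hypertree (fun e => f e : nat))
  \sum_(z : {ffun Eclass G -> 'I_b.+1} | fits (fun e => f e : nat) (fun e => z e : nat))
    weight #|vertex G| (fun e => z e : nat)).
  by apply: eq_bigr => f hf; rewrite fits_sum // rmorphXn /= comp_polyX.
rewrite (exchange_big_dep (fun z : {ffun Eclass G -> 'I_b.+1} => sparse setT (fun e => z e : nat))) /=.
  apply: eq_bigr => z sp.
  have [f /andP[hf fitf]] := fits_exists E0 n1' conn sp.
  rewrite (big_pred1 f) // => f'; apply/andP/eqP => [[hf' fitf']|-> //].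
  exact: fits_unique n0 hf' hf fitf' fitf.
by move=> f z hf; apply: fits_sparse.
Qed.
End Connected.

(** * Connected components *)

Section Components.
Variable G : bigraph.
Local Notation cc := (component (G := G) setT).

Lemma component_eq x y : y \in cc x -> cc y = cc x.
Proof.
rewrite inE => xy; apply/setP => u; rewrite !inE.
by rewrite (same_connect (adj_sym _) xy).
Qed.

Lemma componentsP (C : {set vertex G}) :
  reflect (exists x, C = cc x) (C \in components G).
Proof.
have ccE x : [set y in [set: vertex G] | connect (adj [set: edge G]) x y] = cc x.
  by apply/setP => y; rewrite !inE.
apply: (iffP imsetP) => [[x _ ->]|[x ->]]; first by exists x.
by exists x; rewrite // ccE.
Qed.

Lemma mem_components x C : C \in components G -> (x \in C) = (cc x == C).
Proof.
case/componentsP=> y ->; apply/idP/eqP => [/component_eq //|<-].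
exact: component_refl.
Qed.

Lemma component_in_components x : cc x \in components G.
Proof. by apply/componentsP; exists x. Qed.

Lemma sum_components (I : finType) (h : I -> vertex G) (F : I -> nat) (P : pred I) :
  (\sum_(C in components G) \sum_(i | P i && (h i \in C)) F i = \sum_(i | P i) F i)%N.
Proof.
rewrite [RHS](partition_big (fun i => cc (h i)) (fun C => C \in components G)) /=; last first.
  by move=> i _; apply: component_in_components.
by apply: eq_bigr => C CG; apply: eq_bigl => i; rewrite mem_components.
Qed.

Lemma component_closed C a : C \in components G ->
  (inl (Vend a) \in C) = (inr (Eend a) \in C).
Proof. by case/componentsP=> x ->; apply: component_edge; rewrite inE. Qed.

Definition restrict (C : {set vertex G}) (z : Eclass G -> nat) e :=
  if inr e \in C then z e else 0%N.

Lemma sum_restrict C z : (\sum_e restrict C z e = esum z C)%N.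
Proof. by rewrite -big_mkcond. Qed.

(** A closed set splits along the components into closed sets; adding up, one
strict inequality among the pieces is enough. *)
Lemma sparse_components (z : Eclass G -> nat) :
  sparse (G := G) setT z =
  [forall C in components G, sparse (G := G) setT (restrict C z)].
Proof.
apply/idP/forall_inP => [sp C CG|spC].
  by apply: sparse_le sp => e; rewrite /restrict; case: ifP.
apply/sparseP => U /set0Pn[x xU] clU.
have part C : C \in components G ->
    (esum z (U :&: C) <= #|U :&: C| ?= iff (U :&: C == set0))%N.
  move=> CG; have [->|n0] := eqVneq (U :&: C) set0.
    by rewrite cards0 /esum big1 // => e; rewrite inE.
  apply/leqifP; have clI : eclosed setT (U :&: C).
    apply: eclosedI => //; apply/eclosedP => a _.
    by rewrite component_closed.
  have := sparseP _ _ (spC C CG) _ n0 clI.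
  congr (_ < _)%N; apply: eq_bigr => e; rewrite inE /restrict => /andP[_ ->] //.
have -> : esum z U = (\sum_(C in components G) esum z (U :&: C))%N.
  rewrite /esum -(sum_components inr); apply: eq_bigr => C _.
  by apply: eq_bigl => e; rewrite inE.
have -> : #|U| = (\sum_(C in components G) #|U :&: C|)%N.
  rewrite -sum1_card -(sum_components id); apply: eq_bigr => C _.
  by rewrite -sum1_card; apply: eq_bigl => y; rewrite inE.
rewrite (bigD1 (cc x)) ?component_in_components // [X in (_ < X)%N](bigD1 (cc x)) ?component_in_components //=.
rewrite -addSn; apply: leq_add; last first.
  by apply: leq_sum => C /andP[CG _]; apply: (part C CG).
rewrite (ltn_leqif (part _ (component_in_components x))); apply/set0Pn; exists x.
by rewrite inE xU component_refl.
Qed.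
End Components.

Section Induced.
Variables (G : bigraph) (C : {set vertex G}).
Hypothesis CG : C \in components G.
Local Notation H := (induced C).

Definition embed (x : vertex H) : vertex G :=
  match x with inl v => inl (val v) | inr e => inr (val e) end.

Lemma embed_inj : injective embed.
Proof. by move=> [v|e] [v'|e'] //= [] /val_inj ->. Qed.

Lemma embed_in x : embed x \in C.
Proof. by case: x => [[v vC]|[e eC]]. Qed.

Lemma embed_onto x : x \in C -> exists y, x = embed y.
Proof.
case: x => [v|e] xC; first by exists (inl (exist _ v xC)).
by exists (inr (exist _ e xC)).
Qed.

Lemma card_induced : #|vertex H| = #|C|.
Proof.
rewrite -cardsT -(card_imset _ embed_inj); apply: eq_card => x.
apply/imsetP/idP => [[y _ ->]|/embed_onto[y ->]]; first exact: embed_in.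
by exists y.
Qed.

Lemma edge_inside a : inl (Vend a) \in C -> inside C a.
Proof. by move=> vC; rewrite /inside -component_closed // vC. Qed.

Lemma mem_embed_Vend (U : {set vertex H}) (a : edge H) :
  (inl (Vend (val a)) \in embed @: U) = (inl (Vend a) \in U).
Proof. exact: (mem_imset _ (inl (Vend a)) embed_inj). Qed.

Lemma mem_embed_Eend (U : {set vertex H}) (a : edge H) :
  (inr (Eend (val a)) \in embed @: U) = (inr (Eend a) \in U).
Proof. exact: (mem_imset _ (inr (Eend a)) embed_inj). Qed.

Lemma edge_induced_or_outside a (U : {set vertex H}) :
  (exists a' : edge H, a = val a') \/
  (inl (Vend a) \notin embed @: U /\ inr (Eend a) \notin embed @: U).
Proof.
have [aC|aC] := boolP (inside C a); first by left; exists (exist _ a aC).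
right; split; apply/negP => /imsetP[y _ eqy]; case/negP: aC; apply: edge_inside.
  by rewrite eqy embed_in.
by rewrite component_closed // eqy embed_in.
Qed.

(** A union of components of the induced subgraph is also one of G. *)
Lemma induced_indecomposable : indecomposable (G := H) setT.
Proof.
move=> U /set0Pn[x xU] clU; apply/setP => y; rewrite [RHS]inE.
rewrite -(mem_imset _ _ embed_inj).
have /componentsP[r Cr] := CG.
have inr_r u : u \in C -> u \in component setT r by rewrite Cr.
have sub : component setT r \subset embed @: U.
  rewrite -(component_eq (inr_r _ (embed_in x))).
  apply: component_min; first exact: imset_f.
  move=> a _; have [[a' ->]|[/negbTE-> /negbTE-> //]] := edge_induced_or_outside a U.
  by rewrite mem_embed_Vend mem_embed_Eend clU.
exact: subsetP sub _ (inr_r _ (embed_in y)).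
Qed.

Lemma sum_induced (F : Eclass G -> nat) (P : pred (Eclass G)) :
    (forall e, inr e \notin C -> F e = 0%N) ->
  (\sum_(e' : Eclass H | P (val e')) F (val e') = \sum_(e | P e) F e)%N.
Proof.
move=> F0.
have -> : (\sum_(e | P e) F e = \sum_(e in [pred e : Eclass G | inr e \in C] | P e) F e)%N.
  rewrite [RHS]big_mkcondl; apply: eq_bigr => e _; rewrite inE.
  by case: ifPn => // /F0.
by rewrite big_sub_cond.
Qed.

Lemma sparse_induced (z : Eclass G -> nat) (z' : Eclass H -> nat) :
    (forall e, inr e \notin C -> z e = 0%N) -> (forall e', z (val e') = z' e') ->
  sparse (G := H) setT z' = sparse (G := G) setT z.
Proof.
move=> z0 zz'; apply/sparseP/sparseP => sp U.
  move=> U0 /eclosedP clU.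
  pose U' : {set vertex H} := embed @^-1: U.
  have eU : esum z U = esum z' U'.
    rewrite /esum -(sum_induced (fun e => inr e \in U) z0).
    by apply: eq_big => e'; rewrite ?inE // zz'.
  have [U'0|U'n0] := eqVneq U' set0.
    rewrite eU U'0 /esum big1 ?card_gt0 // => e; by rewrite inE.
  rewrite eU; apply: leq_trans (sp U' U'n0 _) _.
    by apply/eclosedP => a _; rewrite !inE /=; apply: clU; rewrite inE.
  rewrite -(card_imset _ embed_inj); apply: subset_leq_card.
  by apply/subsetP => x /imsetP[y]; rewrite inE => yU ->.
move=> U0 /eclosedP clU.
have -> : esum z' U = esum z (embed @: U).
  rewrite /esum -(sum_induced (fun e => inr e \in embed @: U) z0).
  apply: eq_big => e' => [|_]; last by rewrite zz'.
  exact/esym/(mem_imset _ (inr e') embed_inj).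
rewrite -(card_imset _ embed_inj); apply: sp.
  by case/set0Pn: U0 => x xU; apply/set0Pn; exists (embed x); apply: imset_f.
apply/eclosedP => a _; have [[a' ->]|[_ /negbTE-> //]] := edge_induced_or_outside a U.
by rewrite mem_embed_Vend mem_embed_Eend; apply: clU; rewrite inE.
Qed.

(** Vectors on E that vanish outside C stand for vectors on the E-vertices of the
induced subgraph, so that all components share one index type. *)
Lemma interior_poly_induced b (le : rel (Eclass G)) :
    total le -> antisymmetric le -> transitive le -> (#|vertex G| <= b.+1)%N ->
  interior_poly (@induced_rel G C le) \Po (1 - 'X) =
  \sum_(z : {ffun Eclass G -> 'I_b.+1} |
        [forall e, (inr e \notin C) ==> (z e == ord0)] &&
        sparse (G := G) setT (fun e => z e))
    weight #|C| (fun e => z e).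
Proof.
move=> le_total le_anti le_trans nb.
have n0 : (0 < #|vertex H|)%N.
  rewrite card_induced; have /componentsP[x ->] := CG.
  by apply/card_gt0P; exists x; apply: component_refl.
have nb' : (#|vertex H| <= b.+1)%N.
  by rewrite card_induced; apply: leq_trans nb; apply: max_card.
rewrite (@interior_poly_connected H (@induced_rel G C le) _ _ _ b nb' n0) //; first last.
- exact: induced_indecomposable.
- by move=> x y w; apply: le_trans.
- by move=> x y /le_anti/val_inj.
- by move=> x y; apply: le_total.
pose ext (z : {ffun Eclass H -> 'I_b.+1}) : {ffun Eclass G -> 'I_b.+1} :=
  [ffun e => if insub e is Some e' then z e' else ord0].
pose res (z : {ffun Eclass G -> 'I_b.+1}) : {ffun Eclass H -> 'I_b.+1} :=
  [ffun e' => z (val e')].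
have extV z e' : ext z (val e') = z e' by rewrite ffunE valK.
have ext0 z e : inr e \notin C -> ext z e = ord0 by move=> eC; rewrite ffunE insubN.
rewrite [RHS](reindex_onto ext res) => [|z /andP[/forallP z0 _]]; last first.
  apply/ffunP => e; rewrite ffunE; case: insubP => [e' _ <-|eC]; first by rewrite ffunE.
  by have := z0 e; rewrite eC => /eqP->.
have ext0' z e : inr e \notin C -> ext z e = 0%N :> nat by move=> /ext0->.
apply: eq_big => [z|z _].
  have extV' e' : ext z (val e') = z e' :> nat by rewrite extV.
  rewrite (sparse_induced (ext0' z) extV').
  have -> : res (ext z) = z by apply/ffunP => e'; rewrite ffunE extV.
  rewrite eqxx andbT; apply/esym/andb_idl => _.
  by apply/forallP => e; apply/implyP => /ext0->.
rewrite /weight card_induced; congr ('X^(_ - _) * _ ^+ _).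
  by rewrite -(sum_induced xpredT (ext0' z)); apply: eq_bigr => e' _; rewrite extV.
rewrite -!sum1_card [LHS]big_mkcond [RHS]big_mkcond.
rewrite -(@sum_induced (fun e => if e \in [set e | (0 < ext z e)%N] then 1%N else 0%N) xpredT).
  by apply: eq_bigr => e' _; rewrite !inE extV.
by move=> e eC; rewrite inE ext0'.
Qed.
End Induced.

Section Formula.
Variables (G : bigraph) (le : rel (Eclass G)).
Hypotheses (le_total : total le) (le_anti : antisymmetric le) (le_trans : transitive le).

(** Multiply out the product over components: choosing for each component a sparse
vector supported in it amounts to choosing a sparse vector z of G. *)
Lemma interior_poly'_sparse b : (0 < #|vertex G|)%N -> (#|vertex G| <= b.+1)%N ->
  interior_poly' le \Po (1 - 'X) =
  \sum_(z : {ffun Eclass G -> 'I_b.+1} | sparse (G := G) setT (fun e => z e))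
    weight #|vertex G| (fun e => z e).
Proof.
move=> n0 nb; rewrite /interior_poly' rmorphM rmorphXn rmorphB rmorph1 /= comp_polyX.
rewrite opprB addrC subrK rmorph_prod /=.
under eq_bigr => C CG do rewrite (interior_poly_induced CG le_total le_anti le_trans nb).
pose Z := {ffun Eclass G -> 'I_b.+1}; pose z0 : Z := [ffun=> ord0].
rewrite (big_distr_big_dep z0) /=.
set Q := fun C (z : Z) => _ && _.
(* A family of vectors, one for each component, is glued into one vector by
   reading it at e through the component of e. *)
pose split (z : Z) : {ffun {set vertex G} -> Z} :=
  [ffun C => if C \in components G then
     [ffun e => if inr e \in C then z e else ord0] else z0].
pose glue (s : {ffun {set vertex G} -> Z}) : Z :=
  [ffun e => s (component setT (inr e)) e].
have splitE z C e : C \in components G -> split z C e = restrict C (fun e => z e) e :> nat.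
  by move=> CG; rewrite ffunE CG ffunE /restrict; case: ifP.
rewrite (reindex_onto split glue) => [|s /pfamilyP[sup fam]]; last first.
  apply/ffunP => C; rewrite ffunE; case: ifPn => [CG|CG].
    apply/ffunP => e; rewrite !ffunE; have /andP[/forallP s0 _] := fam C CG.
    case: ifPn => [|/(implyP (s0 e))/eqP //].
    by rewrite mem_components // => /eqP->.
  by apply/esym/eqP; apply: contraR CG => sC; apply: (subsetP sup); rewrite inE.
rewrite mulr_sumr; apply: eq_big => [z|z].
  have -> : glue (split z) = z.
    by apply/ffunP => e; rewrite !ffunE component_in_components ffunE component_refl.
  rewrite eqxx andbT sparse_components; apply/pfamilyP/forall_inP => [[_ fam] C CG|fam].
    have /andP[_] := fam C CG; rewrite (eq_sparse setT (z' := restrict C (fun e => z e))) // => e.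
    exact: splitE.
  split=> [|C CG].
    apply/subsetP => C; rewrite inE ffunE; case: ifP => //; by rewrite eqxx.
  apply/andP; split.
    apply/forallP => e; apply/implyP => eC; rewrite ffunE CG ffunE (negbTE eC) //.
  rewrite (eq_sparse setT (z' := restrict C (fun e => z e))) ?fam // => e.
  exact: splitE.
move=> /andP[/pfamilyP[_ fam] _].
have lt C : C \in components G -> (esum (fun e => z e) C < #|C|)%N.
  move=> CG; have /andP[_ /sparseP sp] := fam C CG.
  have Cn0 : C != set0.
    by have /componentsP[x ->] := CG; apply/set0Pn; exists x; apply: component_refl.
  have := sp C Cn0; rewrite (_ : eclosed _ _); last first.
    by apply/eclosedP => a _; rewrite component_closed.
  move=> /(_ isT); congr (_ < _)%N; apply: eq_bigr => e eC.
  by rewrite splitE // /restrict eC.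
rewrite /weight big_split /= -!expr_sum mulrA -exprD; congr ('X^_ * _ ^+ _); last first.
  rewrite -sum1_card -(sum_components inr); apply: eq_bigr => C CG.
  rewrite -sum1_card; apply: eq_bigl => e; rewrite !inE splitE // /restrict.
  by case: ifP; rewrite ?andbT ?andbF.
have sumz : (\sum_(C in components G) esum (fun e => z e) C = \sum_e z e)%N.
  by rewrite -(sum_components inr).
have sumC : (\sum_(C in components G) #|C| = #|vertex G|)%N.
  rewrite -sum1_card -(sum_components id); apply: eq_bigr => C _.
  by rewrite -sum1_card.
have c0 : (0 < #|components G|)%N.
  by have /card_gt0P[x _] := n0; apply/card_gt0P; exists (component setT x); apply: component_in_components.
have : (\sum_(C in components G) (#|C|.-1 - \sum_e split z C e)
        + (\sum_(C in components G) esum (fun e => z e) C + #|components G|) = #|vertex G|)%N.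
  rewrite -sumC -sum1_card -!big_split /=; apply: eq_bigr => C CG.
  under eq_bigr => e _ do rewrite splitE //.
  rewrite sum_restrict; have arith s m : (s < m)%N -> (m.-1 - s + (s + 1) = m)%N by lia.
  exact/arith/lt.
rewrite sumz; have arith s m k n : (0 < k)%N -> (s + (m + k) = n)%N ->
  (k.-1 + s = n.-1 - m)%N by lia.
exact: arith.
Qed.
End Formula.

Theorem theorem1p2 (G : signed_bigraph) (le : rel (Eclass G))
    (le_total : total le) (le_anti : antisymmetric le) (le_trans : transitive le)
    (alt : exists c : seq (vertex G * edge G), alternating_cycle c) :
  signed_interior_poly le = 0.
Proof.
have [c altc] := alt.
have n0 : (0 < #|vertex G|)%N.
  by case: c altc => // -[x a] c _; apply/card_gt0P; exists x.
have [b nb] : exists b, (#|vertex G| <= b.+1)%N by exists #|vertex G|.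
have subst0 : signed_interior_poly le \Po (1 - 'X) = 0.
  rewrite rmorph_sum /=.
  transitivity (\sum_(S : {set edge G} | S \subset neg_edges G)
    \sum_(z : {ffun Eclass G -> 'I_b.+1})
      weight #|vertex G| (fun e => z e) *
      ((-1) ^+ #|S| * (sparse (~: S) (fun e => z e : nat))%:R)%:P).
    apply: eq_bigr => S _.
    rewrite rmorphM rmorphXn rmorphN1 /=.
    rewrite (@interior_poly'_sparse (delete_edges S) le le_total le_anti le_trans b) //.
    rewrite mulr_sumr big_mkcond /=; apply: eq_bigr => z _.
    rewrite sparse_delete polyCM rmorphXn rmorphN1 /=.
    by case: (sparse _ _); rewrite ?mulr1 ?mulr0 // mulrC.
  rewrite exchange_big big1 //= => z _.
  by rewrite -mulr_sumr -rmorph_sum /= (alternating_sparse_sum0 _ altc) mulr0.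
(* The substitution of 1 - x for x is an involution. *)
have := congr1 (fun p => p \Po (1 - 'X)) subst0.
rewrite -comp_polyA comp_polyB comp_polyC comp_polyX opprB addrC subrK comp_polyXr.
by rewrite comp_poly0.
Qed.
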